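(* For every integer $n>1$ we have $\tau(n) > n^2/8$.
   Context: A word of length $n$ is a finite sequence $x=x[1\ldots n]$ of letters from some alphabet (alphabets of any size are allowed); $x[i\ldots j]$ denotes the factor occupying positions $i$ through $j$. A word has period $p\ge 1$ if $x[i]=x[i+p]$ whenever both positions lie in the word. A run in $x$ is an occurrence of a factor $x[i\ldots j]$ (identified by its pair of positions $(i,j)$) with minimum period $p$, of length $j-i+1\ge 2p$, and such that neither $x[i-1\ldots j]$ nor $x[i\ldots j+1]$ is a factor of $x$ with period $p$ (an extension that leaves the range of positions $1,\dots,n$ is not a factor). The total run length $TRL(w)$ of a word $w$ is the sum of the lengths of all runs in $w$ (runs at different positions are counted separately). Define $\tau(n)=\max\{TRL(w): |w|=n\}$, the maximum over all words of length $n$ over any alphabet. *)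

(* Defs.v *)
From mathcomp Require Import all_boot.
From mathcomp Require Import boolp.

Set Implicit Arguments.
Unset Strict Implicit.
Unset Printing Implicit Defensive.

(* A word is a sequence [x : seq T] over an [eqType] [T].  Positions in a word
   are numbered from 1, as is usual in combinatorics on words. *)

Definition letter (T : eqType) (x : seq T) (i : nat) : option T := onth x i.-1.

(* x[i .. j], for 1 <= i <= j <= size x *)
Definition factor (T : eqType) (x : seq T) (i j : nat) : seq T :=
  drop i.-1 (take j x).

(* The quantifier on [i] ranges over 0, ..., size x; 0 is not a position. *)
Definition has_period (T : eqType) (p : nat) (x : seq T) : bool :=
  (1 <= p) &&
  [forall i : 'I_(size x).+1,
     (1 <= i) && (i + p <= size x) ==> (letter x i == letter x (i + p))].

Definition min_period (T : eqType) (p : nat) (x : seq T) : bool :=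
  has_period p x && [forall q : 'I_p, ~~ has_period q x].

Definition run_with_period (T : eqType) (x : seq T) (i j p : nat) : bool :=
  [&& [&& 1 <= i, i <= j & j <= size x],
      min_period p (factor x i j),
      2 * p <= j - i + 1,
      ~~ ((1 <= i - 1) && has_period p (factor x (i - 1) j)) &
      ~~ ((j + 1 <= size x) && has_period p (factor x i (j + 1)))].

(* Bounding p by size x loses nothing, since 2 * p <= j - i + 1 <= size x. *)
Definition is_run (T : eqType) (x : seq T) (i j : nat) : bool :=
  [exists p : 'I_(size x).+1, run_with_period x i j p].

Definition TRL (T : eqType) (x : seq T) : nat :=
  \sum_(1 <= i < (size x).+1) \sum_(1 <= j < (size x).+1 | is_run x i j)
    (j - i + 1).

Definition TRL_value (n t : nat) : Prop :=
  exists (T : eqType) (x : seq T), size x = n /\ TRL x = t.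

Lemma TRL_value_exists (n : nat) : exists t, `[< TRL_value n t >].
Proof.
exists (TRL (nseq n tt)); apply/asboolP.
by exists unit, (nseq n tt); rewrite size_nseq.
Qed.

Lemma TRL_value_bounded (n t : nat) : `[< TRL_value n t >] -> t <= n * (n * n.+1).
Proof.
move=> /asboolP [T [x [<- <-]]]; set m := size x.
have bnd F c : (forall i, 1 <= i < m.+1 -> F i <= c) ->
    \sum_(1 <= i < m.+1) F i <= m * c.
  move=> Fc.
  have -> : m * c = \sum_(1 <= i < m.+1) c by rewrite sum_nat_const_nat subn1.
  by rewrite big_nat [leqRHS]big_nat; apply: leq_sum.
apply: (bnd) => i _; rewrite big_mkcond; apply: bnd => j /andP[_ jm].
case: ifP => // _; rewrite addn1 ltnS.
by apply: leq_trans (leq_subr _ _) _.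
Qed.

(* The maximum of TRL over the words of length n over all alphabets. *)
Definition tau (n : nat) : nat :=
  ex_maxn (TRL_value_exists n) (@TRL_value_bounded n).

Lemma tauP (n : nat) :
  TRL_value n (tau n) /\
  forall (T : eqType) (x : seq T), size x = n -> TRL x <= tau n.
Proof.
rewrite /tau; case: ex_maxnP => t /asboolP tn tmax; split=> // T x xn.
by apply: tmax; apply/asboolP; exists T, x.
Qed.

(* Main.v *)
Require Import Defs.
From mathcomp Require Import all_boot all_order all_algebra.
From mathcomp Require Import zify.

Import Order.TTheory GRing.Theory Num.Theory.
Local Open Scope ring_scope.

(** A quadratic total run length needs linearly many runs of linear length, and
    a single defect in an alternating word provides them.  Take the word
      abab...ab|baba...   of length n,
    whose left part has even length l = 2k and whose right part is at least as
    long.  For each odd p <= l, the p letters before the bar and the p letters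
    after it spell the same alternating word b a b ... b, so they form a square
    of period p centred at the bar.  It is a run: the double letter bb occurs in
    it only once, so no period is smaller than p, and an extension to either side
    compares two letters at odd distance in an alternating word, which differ.
    These k runs have total length 2 (1 + 3 + ... + (2k - 1)) = 2 k^2, and the
    two alternating halves, runs of period 2 as soon as they have length at
    least 4, add n.  With k = n %/ 4 the resulting bound 2 k^2 + n exceeds
    n^2 / 8.  The halves are too short when n < 8, but then n itself exceeds
    n^2 / 8, and a power of a single letter is a run of length n.

    The runs centred at the bar are given by [defect_run_centre], the alternating
    halves by [defect_run_left] and [defect_run_right], and [TRL_lower_bound] adds
    their lengths up. *)

(** The factor at positions [a.+1 .. b] is the slice [drop a (take b x)], so the
    0-based half-open interval [a, b) describes it without predecessors. *)
Lemma has_period_sliceP {T : eqType} (x0 : T) {x : seq T} {a b p : nat} :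
  (b <= size x)%N ->
  reflect ((0 < p)%N /\ forall t, (a <= t)%N -> (t + p < b)%N ->
             nth x0 x t = nth x0 x (t + p)%N)
          (has_period p (drop a (take b x))).
Proof.
move=> bx.
have szs : size (drop a (take b x)) = (b - a)%N by rewrite size_drop size_takel.
have letE i : (0 < i <= b - a)%N ->
    letter (drop a (take b x)) i = Some (nth x0 x (a + i.-1)).
  move=> ib; rewrite /letter onthE (nth_map x0) ?szs; last lia.
  by rewrite nth_drop nth_take //; lia.
apply: (iffP andP) => -[p0 Hp]; split=> //.
- move=> t at_ tb; rewrite szs in Hp.
  have it : ((t - a).+1 < (b - a).+1)%N by lia.
  have := forallP Hp (Ordinal it) => /= /implyP/(_ _)/eqP.
  rewrite !letE; try lia.
  have -> : (a + (t - a).+1.-1 = t)%N by lia.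
  have -> : (a + ((t - a).+1 + p).-1 = t + p)%N by lia.
  move=> H; suff /H[] : (((t - a).+1 + p <= b - a)%N) by [].
  lia.
- apply/forallP => -[i /= _]; apply/implyP; rewrite szs => ib.
  apply/eqP; rewrite !letE; try lia.
  have -> : (a + (i + p).-1 = a + i.-1 + p)%N by lia.
  by congr Some; apply: Hp; lia.
Qed.

(** Minimality of the period and maximality of the interval each reduce to one
    mismatch: one for every smaller shift, and one at each end of the interval
    that is not an end of the word. *)
Lemma is_run_slice (T : eqType) (x0 : T) (x : seq T) (a b p : nat) :
  (0 < p)%N -> (2 * p <= b - a)%N -> (b <= size x)%N ->
  (forall t, (a <= t)%N -> (t + p < b)%N -> nth x0 x t = nth x0 x (t + p)%N) ->
  (forall q, (0 < q < p)%N -> exists t,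
     [/\ (a <= t)%N, (t + q < b)%N & nth x0 x t != nth x0 x (t + q)%N]) ->
  ((0 < a)%N -> nth x0 x a.-1 != nth x0 x (a.-1 + p)%N) ->
  ((b < size x)%N -> nth x0 x (b - p)%N != nth x0 x b) ->
  is_run x a.+1 b.
Proof.
move=> p0 pab bx per minp left right.
have px : (p < (size x).+1)%N by lia.
apply/existsP; exists (Ordinal px); rewrite /run_with_period /=.
apply/and5P; split.
- lia.
- rewrite /min_period /factor /=; apply/andP; split.
    by apply/(has_period_sliceP x0 bx).
  apply/forallP => q; apply/negP => /(has_period_sliceP x0 bx)[q0 perq].
  have [|t [at_ tb]] := minp q; first by have := ltn_ord q; lia.
  by rewrite perq ?eqxx.
- lia.
- rewrite /factor subn1 /=; apply/negP => /andP[a0].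
  case/(has_period_sliceP x0 bx) => _ /(_ a.-1) H.
  by have := left a0; rewrite H ?eqxx //; lia.
- rewrite /factor addn1 /=; apply/negP => /andP[bx'].
  case/(has_period_sliceP x0 bx') => _ /(_ (b - p)%N).
  have -> : (b - p + p = b)%N by lia.
  by move=> H; have := right bx'; rewrite H ?eqxx //; lia.
Qed.

Lemma TRL_lower_bound (T : eqType) (x : seq T) (s : seq (nat * nat)) :
  uniq s -> {in s, forall r, (r.1 < r.2 <= size x)%N && is_run x r.1.+1 r.2} ->
  (\sum_(r <- s) (r.2 - r.1) <= TRL x)%N.
Proof.
move=> us runs; rewrite /TRL.
set I := index_iota 1 (size x).+1.
have -> : (\sum_(i <- I) \sum_(j <- I | is_run x i j) (j - i + 1) =
    \sum_(r <- [seq (i, j) | i <- I, j <- I])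
       if is_run x r.1 r.2 then r.2 - r.1 + 1 else 0)%N.
  by rewrite big_allpairs /=; apply: eq_bigr => i _; rewrite big_mkcond.
pose shift (r : nat * nat) := (r.1.+1, r.2).
have sE : (\sum_(r <- s) (r.2 - r.1) = \sum_(r <- map shift s)
       if is_run x r.1 r.2 then r.2 - r.1 + 1 else 0)%N.
  rewrite big_map big_seq [RHS]big_seq; apply: eq_bigr => r /runs /=.
  by case/andP=> ab -> ; lia.
rewrite sE.
apply: (@uniq_sub_le_big _ addn leq) => //.
- by move=> i j; exact: leq_addr.
- by rewrite map_inj_uniq // => -[a b] [c d] [-> ->].
- by rewrite allpairs_uniq ?iota_uniq // => -[? ?] [? ?].
- move=> _ /mapP[r /runs rb ->]; apply: allpairs_f; rewrite mem_index_iota; lia.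
Qed.

Lemma TRL_nseq {T : eqType} (c : T) {n : nat} :
  (1 < n)%N -> (n <= TRL (nseq n c))%N.
Proof.
move=> n1; have := @TRL_lower_bound _ (nseq n c) [:: (0, n)%N].
rewrite big_seq1 /= subn0; apply=> // _ /[!inE]/eqP-> /=.
rewrite size_nseq leqnn andbT; apply/andP; split; first lia.
apply: (@is_run_slice _ c _ _ _ 1); rewrite ?size_nseq //; try lia.
by move=> t _ tn; rewrite !nth_nseq !ifT //; lia.
Qed.

Definition defect_word (l n : nat) : seq bool :=
  mkseq (fun t => odd t (+) (l <= t)%N) n.

Lemma defect_run_left (l n : nat) :
  ~~ odd l -> (4 <= l <= n)%N -> is_run (defect_word l n) 1 l.
Proof.
move=> evl ln.
apply: (@is_run_slice _ false _ 0 l 2); rewrite ?size_mkseq //; try lia.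
- by move=> t _ tl; rewrite !nth_mkseq; lia.
- by move=> q q2; exists 0%N; split; rewrite ?nth_mkseq; lia.
- by move=> ltn; rewrite !nth_mkseq; lia.
Qed.

Lemma defect_run_right (l n : nat) :
  (0 < l)%N -> (l + 4 <= n)%N -> is_run (defect_word l n) l.+1 n.
Proof.
move=> l0 ln.
apply: (@is_run_slice _ false _ l n 2); rewrite ?size_mkseq //; try lia.
- by move=> t tl tn; rewrite !nth_mkseq; lia.
- by move=> q q2; exists l; split; rewrite ?nth_mkseq; lia.
- by move=> _; rewrite !nth_mkseq; lia.
Qed.

(** Equal letters on the two sides of the bar have opposite parities of position,
    so a shift by an odd [p] across the bar preserves letters, and any odd shift
    within one half changes them: hence the square, and its maximality. *)
Lemma defect_run_centre (l n p : nat) :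
  odd p -> (p <= l)%N -> (l + p <= n)%N ->
  is_run (defect_word l n) (l - p).+1 (l + p).
Proof.
move=> oddp pl pn.
apply: (@is_run_slice _ false _ (l - p) (l + p) p);
  rewrite ?size_mkseq //; try lia.
- by move=> t tl tn; rewrite !nth_mkseq; lia.
- move=> q q2.
  (* The double letter at [l.-1], [l] is not repeated [q] places further on:
     an even shift of [l.-1] crosses the defect and so changes the letter,
     while an odd shift of [l] stays in the right half, which alternates. *)
  case oq: (odd q); last by exists l.-1; split; rewrite ?nth_mkseq; lia.
  by exists l; split; rewrite ?nth_mkseq; lia.
- by move=> ?; rewrite !nth_mkseq; lia.
- by move=> ?; rewrite !nth_mkseq; lia.
Qed.

(** The terms [n] and [2 * k ^ 2] are the lengths of the two halves and of the
    squares of odd periods [2 * i + 1], [i < k], centred at the defect. *)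
Lemma TRL_defect_word {k n : nat} :
  (1 < k)%N -> (4 * k <= n)%N ->
  (2 * k ^ 2 + n <= TRL (defect_word (2 * k) n))%N.
Proof.
move=> k1 kn; set l := (2 * k)%N.
pose centre i := (l - (2 * i + 1), l + (2 * i + 1))%N.
pose s := [:: (0, l), (l, n) & map centre (iota 0 k)]%N.
have sumE : (\sum_(r <- s) (r.2 - r.1) = 2 * k ^ 2 + n)%N.
  rewrite !big_cons big_map /=.
  have -> : (\sum_(i <- iota 0 k) (l + (2 * i + 1) - (l - (2 * i + 1))) =
             \sum_(i <- iota 0 k) (4 * i + 2))%N.
    rewrite big_seq [RHS]big_seq; apply: eq_bigr => i.
    by rewrite mem_iota /l; lia.
  have -> : (\sum_(i <- iota 0 k) (4 * i + 2) = 2 * k ^ 2)%N.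
    elim: (k) => [|m IHm]; first by rewrite big_nil.
    by rewrite -addn1 iotaD big_cat IHm big_seq1 /= add0n; nia.
  by rewrite /l; lia.
rewrite -sumE; apply: TRL_lower_bound.
- rewrite /= inE negb_or map_inj_uniq ?iota_uniq ?andbT; last first.
    by move=> i j [_]; lia.
  apply/andP; split; first apply/andP; first split.
  + by rewrite xpair_eqE /l; lia.
  + by apply/mapP => -[i _ []]; lia.
  + by apply/mapP => -[i]; rewrite mem_iota => ? []; rewrite /l; lia.
- move=> r; rewrite !inE size_mkseq => /or3P[/eqP->|/eqP->|] /=.
  + by rewrite defect_run_left ?andbT /l; lia.
  + by rewrite defect_run_right ?andbT /l; lia.
  + case/mapP=> i; rewrite mem_iota => ik -> /=.
    by rewrite defect_run_centre ?andbT /l; lia.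
Qed.

Lemma tau_lower_bound (n : nat) : (1 < n)%N -> (n ^ 2 < 8 * tau n)%N.
Proof.
move=> n1; have [_ max] := tauP n.
have [n8|n8] := ltnP n 8.
  have := leq_trans (TRL_nseq tt n1) (max _ _ (size_nseq _ _)).
  by nia.
have k1 : (1 < n %/ 4)%N by lia.
have kn : (4 * (n %/ 4) <= n)%N by lia.
have := leq_trans (TRL_defect_word k1 kn) (max _ _ (size_mkseq _ _)).
(* For n = 4 k + r this is r^2 < 8 k (4 - r) + 8 r, true since r <= 3. *)
have : (n < 4 * (n %/ 4) + 4)%N by lia.
by move: (n %/ 4)%N k1 kn => k; nia.
Qed.

Theorem theorem2 (n : nat) (hn : (1 < n)%N) :
  n%:R ^+ 2 / 8 < (tau n)%:R :> rat.
Proof.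
rewrite ltr_pdivrMr // mulrC -natrX -natrM ltr_nat.
exact: tau_lower_bound.
Qed.
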